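(* Let $G=(V,E)$ be a finite simple graph with non-negative edge weights and $|V|=n$. For any optimal primal solution $\mathbf{X}^*$ of the MAXCUT SDP of $G$ and corresponding optimal dual solution (slack matrix) $\mathbf{S}^*$ of the MAXCUT DUAL SDP of $G$, $$\operatorname{rank}(\mathbf{X}^* )+\operatorname{rank}(\mathbf{S}^* )=n-\dim\left(\mathcal{N}(\mathbf{X}^* )\cap\mathcal{N}(\mathbf{S}^* )\right).$$
   Context: $\mathcal{N}(\cdot)$ denotes the nullspace. The Laplacian $\mathcal{L}_G$ of a graph $G=(V,E)$ with edge weights $w_{ij}$ ($w_{ij}=0$ for non-edges) is the $V\times V$ matrix with off-diagonal entries $-w_{ij}$ and diagonal entries $\sum_{j\ne i}w_{ij}$. The MAXCUT SDP of $G$ is: maximize $\frac14\langle \mathcal{L}_G,\mathbf{X}\rangle$ over symmetric matrices $\mathbf{X}\in\mathbb{R}^{V\times V}$ with $X_{ii}=1$ for all $i\in V$ and $\mathbf{X}\succeq \mathbf{0}$, where $\langle \mathbf{A},\mathbf{B}\rangle=\operatorname{tr}(\mathbf{A}\mathbf{B})$. The MAXCUT DUAL SDP of $G$ is: minimize $\sum_{i\in V}y_i$ over $y\in\mathbb{R}^{V}$ and $\mathbf{S}$ subject to $\mathbf{S}=\operatorname{Diag}(y)-\frac14\mathcal{L}_G$ and $\mathbf{S}\succeq\mathbf{0}$; an optimal dual solution is identified with its slack matrix $\mathbf{S}^*$. *)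

(* Defs.v *)
From mathcomp Require Import all_boot all_order all_algebra.
From mathcomp Require Import reals.

Set Implicit Arguments.
Unset Strict Implicit.
Unset Printing Implicit Defensive.

Import Order.TTheory GRing.Theory Num.Theory.
Local Open Scope ring_scope.

(* The vertex set is 'I_n; e is the adjacency relation. The weights form a
   symmetric function of ordered pairs of vertices, extended by 0 outside of
   the edges; an edge may have weight 0. *)
Definition simple_graph (n : nat) (e : rel 'I_n) : Prop :=
  symmetric e /\ irreflexive e.

Definition edge_weights (R : realType) (n : nat) (e : rel 'I_n)
    (w : 'I_n -> 'I_n -> R) : Prop :=
  (forall i j, w i j = w j i) /\ (forall i j, ~~ e i j -> w i j = 0).

Definition laplacian (R : realType) (n : nat) (w : 'I_n -> 'I_n -> R)
    : 'M[R]_n :=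
  \matrix_(i, j) if i == j then \sum_(k | k != i) w i k else - w i j.

Definition psd (R : realType) (n : nat) (A : 'M[R]_n) : Prop :=
  A^T = A /\ forall x : 'cV[R]_n, 0 <= (x^T *m A *m x) 0 0.

Definition mxinner (R : realType) (n : nat) (A B : 'M[R]_n) : R :=
  \tr (A *m B).

Definition maxcut_obj (R : realType) (n : nat) (w : 'I_n -> 'I_n -> R)
    (X : 'M[R]_n) : R :=
  4^-1 * mxinner (laplacian w) X.

Definition maxcut_feasible (R : realType) (n : nat) (X : 'M[R]_n) : Prop :=
  (forall i, X i i = 1) /\ psd X.

Definition maxcut_optimal (R : realType) (n : nat) (w : 'I_n -> 'I_n -> R)
    (X : 'M[R]_n) : Prop :=
  maxcut_feasible X /\
  forall Z : 'M[R]_n, maxcut_feasible Z -> maxcut_obj w Z <= maxcut_obj w X.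

Definition dual_obj (R : realType) (n : nat) (y : 'rV[R]_n) : R :=
  \sum_(i < n) y 0 i.

Definition dual_feasible (R : realType) (n : nat) (w : 'I_n -> 'I_n -> R)
    (y : 'rV[R]_n) (S : 'M[R]_n) : Prop :=
  S = diag_mx y - 4^-1 *: laplacian w /\ psd S.

Definition dual_optimal (R : realType) (n : nat) (w : 'I_n -> 'I_n -> R)
    (y : 'rV[R]_n) (S : 'M[R]_n) : Prop :=
  dual_feasible w y S /\
  forall (z : 'rV[R]_n) (T : 'M[R]_n),
    dual_feasible w z T -> dual_obj y <= dual_obj z.

(* A square matrix whose row space is {x | A x = 0}, the vectors x being
   written as rows; the transpose is there because kermx is the left kernel. *)
Definition nullspace (R : realType) (n : nat) (A : 'M[R]_n) : 'M[R]_n :=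
  kermx A^T.

Lemma nullspaceP (R : realType) (n : nat) (A : 'M[R]_n) (x : 'cV[R]_n) :
  reflect (A *m x = 0) (x^T <= nullspace A)%MS.
Proof.
rewrite /nullspace sub_kermx -trmx_mul trmx_eq0; exact: eqP.
Qed.

(* Main.v *)
Require Import Defs.
From mathcomp Require Import all_boot all_order all_algebra.
From mathcomp Require Import reals.
From mathcomp Require Import boolp classical_sets topology normedtype derive.
From mathcomp Require Import ring lra.

Set Implicit Arguments.
Unset Strict Implicit.
Unset Printing Implicit Defensive.

Import Order.TTheory GRing.Theory Num.Theory.
Import numFieldNormedType.Exports.
Local Open Scope ring_scope.

(** The identity says that X and S have complementary ranges up to their common
    kernel, and it follows from complementary slackness, S X = 0. Indeed, as X
    and S are symmetric, S X = 0 makes their row spaces orthogonal, so rank X +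
    rank S is the dimension of the sum of the row spaces, whose orthogonal
    complement is the common kernel ([mxrank_orthogonal]).

    Since tr (S X) is the difference of the dual and the primal objective values
    ([duality_gap]), and two positive semidefinite matrices of inner product 0
    have product 0 ([psd_inner_eq0]), complementary slackness amounts to strong
    duality: some primal feasible Z has tr (S Z) = 0. Strong duality is proved
    without a separation theorem or Slater's condition. Among the positive
    semidefinite matrices of trace n, which form a compact convex set, take an X0
    minimizing the sum of the (X_ii - 1)^2 plus <S, X>^2. If the minimum is 0,
    then X0 is the required Z. Otherwise let delta > 0 be the minimum, let
    d_i = X0_ii - 1, which sum to 0, and let s = <S, X0> >= 0. The first order
    condition at X0, tested on the multiples of x x^T, says that
    s S + Diag (d - delta / n) is positive semidefinite. Adding S and dividing by
    1 + s gives a dual feasible matrix S + Diag z whose z has the negative sum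
    - delta / (1 + s), against the optimality of S ([psd_alternative]). *)

(** * Quadratic forms of positive semidefinite matrices *)

Definition mxform (R : realType) (n : nat) (A : 'M[R]_n) (x z : 'cV[R]_n) : R :=
  (x^T *m A *m z) 0 0.

Lemma mxformDl (R : realType) (n : nat) (A : 'M[R]_n) (a : R) (x y z : 'cV[R]_n) :
  mxform A (a *: x + y) z = a * mxform A x z + mxform A y z.
Proof.
by rewrite /mxform -!trace_mx11 linearD linearZ /= !mulmxDl -!scalemxAl mxtraceD mxtraceZ.
Qed.

Lemma mxformDr (R : realType) (n : nat) (A : 'M[R]_n) (a : R) (x y z : 'cV[R]_n) :
  mxform A x (a *: y + z) = a * mxform A x y + mxform A x z.
Proof.
by rewrite /mxform -!trace_mx11 mulmxDr -scalemxAr mxtraceD mxtraceZ.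
Qed.

Lemma mxform_sym (R : realType) (n : nat) (A : 'M[R]_n) (x z : 'cV[R]_n) :
  A^T = A -> mxform A x z = mxform A z x.
Proof.
move=> sA; rewrite /mxform -!trace_mx11 -mxtrace_tr.
by rewrite !trmx_mul trmxK sA mulmxA.
Qed.

Lemma mxform_inner (R : realType) (n : nat) (A : 'M[R]_n) (x : 'cV[R]_n) :
  mxform A x x = mxinner A (x *m x^T).
Proof. by rewrite /mxinner mulmxA mxtrace_mulC mulmxA trace_mx11. Qed.

Lemma mxform_delta (R : realType) (n : nat) (A : 'M[R]_n) (i j : 'I_n) :
  mxform A (delta_mx i 0) (delta_mx j 0) = A i j.
Proof. by rewrite /mxform trmx_delta -rowE -colE !mxE. Qed.

Lemma mxform1 (R : realType) (n : nat) (x : 'cV[R]_n) :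
  mxform 1%:M x x = \sum_i x i 0 ^+ 2.
Proof. by rewrite /mxform mulmx1 mxE; apply: eq_bigr => i _; rewrite mxE. Qed.

Lemma mxform1_eq0 (R : realType) (n : nat) (x : 'cV[R]_n) :
  mxform 1%:M x x = 0 -> x = 0.
Proof.
rewrite mxform1 => /eqP; rewrite psumr_eq0; last by move=> i _; exact: sqr_ge0.
move=> /allP x0; apply/colP => i; rewrite mxE.
by apply/eqP; rewrite -sqrf_eq0; apply: x0; rewrite mem_index_enum.
Qed.

(** The discriminant of a nonnegative binary quadratic form. The pairs (c, -b)
    and (-b, a) give c (ac - b^2) >= 0 and a (ac - b^2) >= 0, which settles the
    case where a or c is nonzero; if both vanish, then (1, 1) and (1, -1) force
    b = 0. *)
Lemma form_CauchySchwarz (R : realType) (a b c : R) :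
  (forall s t, 0 <= s ^+ 2 * a + 2 * (s * t) * b + t ^+ 2 * c) ->
  b ^+ 2 <= a * c.
Proof.
move=> H.
have a0 := H 1 0; have c0 := H 0 1; have h1 := H c (- b); have h2 := H (- b) a.
have h3 := H 1 1; have h4 := H 1 (- 1).
have {}a0 : 0 <= a by lra.
have {}c0 : 0 <= c by lra.
have {}h1 : 0 <= c * (a * c - b ^+ 2) by lra.
have {}h2 : 0 <= a * (a * c - b ^+ 2) by lra.
rewrite -subr_ge0.
move: a0; rewrite le_eqVlt => /orP[/eqP a0|a0]; last by rewrite pmulr_rge0 in h2.
move: c0; rewrite le_eqVlt => /orP[/eqP c0|c0]; last by rewrite pmulr_rge0 in h1.
have -> : b = 0 by lra.
by rewrite -a0 mul0r expr2 mulr0 subrr.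
Qed.

Lemma psd_CauchySchwarz (R : realType) (n : nat) (A : 'M[R]_n) (x z : 'cV[R]_n) :
  psd A -> mxform A x z ^+ 2 <= mxform A x x * mxform A z z.
Proof.
move=> [sA pA]; apply: form_CauchySchwarz => s t.
(* The summand 0 puts the vector in the shape a *: u + v of mxformDl. *)
have := pA (s *: x + (t *: z + 0)); rewrite -/(mxform A _ _).
rewrite !mxformDl !mxformDr.
have m0 u : mxform A u 0 = 0 by rewrite /mxform mulmx0 mxE.
have m0' u : mxform A 0 u = 0 by rewrite /mxform trmx0 !mul0mx mxE.
rewrite !m0 !m0' (mxform_sym z x sA); lra.
Qed.

(** By Cauchy-Schwarz, an isotropic x is orthogonal, for the form of A, to every
    vector, in particular to A x. *)
Lemma psd_isotropic (R : realType) (n : nat) (A : 'M[R]_n) (x : 'cV[R]_n) :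
  psd A -> mxform A x x = 0 -> A *m x = 0.
Proof.
move=> pA x0; apply: mxform1_eq0.
have -> : mxform 1%:M (A *m x) (A *m x) = mxform A (A *m x) x.
  by rewrite /mxform mulmx1 mulmxA.
apply/eqP; rewrite -sqrf_eq0; apply/eqP/le_anti; rewrite sqr_ge0 andbT.
by have := psd_CauchySchwarz (A *m x) x pA; rewrite x0 mulr0.
Qed.

Lemma psd_diag_eq0 (R : realType) (n : nat) (A : 'M[R]_n) (i : 'I_n) :
  psd A -> A i i = 0 -> forall j, A i j = 0.
Proof.
move=> pA Aii j.
have /matrixP/(_ j 0) : A *m (delta_mx i 0 : 'cV_n) = 0.
  by apply: psd_isotropic => //; rewrite mxform_delta.
by rewrite -colE !mxE -{1}pA.1 mxE.
Qed.

(** One step of the Cholesky elimination, with pivot A_ii: that the remainder is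
    positive semidefinite is exactly Cauchy-Schwarz against the i-th basis
    vector. *)
Lemma psd_schur (R : realType) (n : nat) (A : 'M[R]_n) (i : 'I_n) :
  psd A -> 0 < A i i ->
  psd (A - (A i i)^-1 *: (col i A *m (col i A)^T)).
Proof.
move=> pA Aii; split.
  by rewrite linearB linearZ /= trmx_mul trmxK pA.1.
move=> x; rewrite mulmxBr mulmxBl -scalemxAr -scalemxAl.
have e1 : x^T *m (col i A *m (col i A)^T) *m x
    = (x^T *m A *m delta_mx i 0) *m (x^T *m A *m (delta_mx i 0 : 'cV_n))^T.
  by rewrite !trmx_mul trmxK !colE !trmx_mul pA.1 !mulmxA.
rewrite e1 -trace_mx11 linearB linearZ /= !trace_mx11.
have -> (u : 'M[R]_1) : (u *m u^T) 0 0 = u 0 0 ^+ 2.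
  by rewrite mxE big_ord1 mxE expr2.
rewrite -/(mxform A x x) -/(mxform A x (delta_mx i 0)).
have := psd_CauchySchwarz x (delta_mx i 0) pA; rewrite mxform_delta => CS.
by rewrite subr_ge0 ler_pdivrMl // mulrC.
Qed.

Lemma psd_diag_ge0 (R : realType) (n : nat) (A : 'M[R]_n) (i : 'I_n) :
  psd A -> 0 <= A i i.
Proof. by move=> pA; have := pA.2 (delta_mx i 0); rewrite -/(mxform _ _ _) mxform_delta. Qed.

(** The Cholesky decomposition, which stands in for the square root of A. Each
    elimination step annihilates a nonzero diagonal entry and keeps the zero
    ones, as a zero on the diagonal comes with a zero row; so the number of
    nonzero diagonal entries decreases. *)
Lemma psd_rank1_sum (R : realType) (n : nat) (A : 'M[R]_n) :
  psd A -> exists s : seq 'cV[R]_n, A = \sum_(v <- s) v *m v^T.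
Proof.
have [m] := ubnP #|[set i | A i i != 0]|; elim: m A => // m IHm A leAm pA.
have [/existsP[i nz]|] := boolP [exists i, A i i != 0]; last first.
  rewrite negb_exists => /forallP A0; exists [::]; rewrite big_nil.
  apply/matrixP => i j; rewrite mxE; apply: psd_diag_eq0 => //.
  by apply/eqP; move: (A0 i); rewrite negbK.
have Aii : 0 < A i i by rewrite lt_def nz psd_diag_ge0.
set B := A - (A i i)^-1 *: (col i A *m (col i A)^T).
have BE j : B j j = A j j - (A i i)^-1 * A j i ^+ 2.
  by rewrite !mxE big_ord1 !mxE expr2.
have [||s Bs] := IHm B.
- apply: leq_trans (proper_card _) (leAm : _ <= m)%N.
  apply/properP; split.
    apply/fintype.subsetP => j; rewrite !inE BE; apply: contraNN => /eqP Ajj.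
    by rewrite (psd_diag_eq0 pA Ajj i) Ajj expr0n mulr0 subr0.
  exists i; rewrite !inE // BE negbK expr2 mulrA mulVf // mul1r subrr //.
- exact: psd_schur.
exists ((Num.sqrt (A i i))^-1 *: col i A :: s); rewrite big_cons -Bs.
rewrite linearZ /= -scalemxAl -scalemxAr scalerA -invfM -expr2 sqr_sqrtr ?ltW //.
by rewrite /B addrC subrK.
Qed.

Lemma mxinner_rank1_sum (R : realType) (n : nat) (A : 'M[R]_n) (s : seq 'cV[R]_n) :
  mxinner A (\sum_(v <- s) v *m v^T) = \sum_(v <- s) mxform A v v.
Proof.
rewrite /mxinner mulmx_sumr raddf_sum /=.
by apply: eq_bigr => v _; rewrite mxform_inner.
Qed.

Lemma psd_inner_ge0 (R : realType) (n : nat) (A B : 'M[R]_n) :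
  psd A -> psd B -> 0 <= mxinner A B.
Proof.
move=> pA /psd_rank1_sum[s ->]; rewrite mxinner_rank1_sum.
by apply: sumr_ge0 => v _; apply: pA.2.
Qed.

(** Writing B as a sum of matrices v v^T turns the inner product into a sum of
    the nonnegative numbers v^T A v; if it is 0, every v is isotropic for A,
    hence in its kernel. *)
Lemma psd_inner_eq0 (R : realType) (n : nat) (A B : 'M[R]_n) :
  psd A -> psd B -> mxinner A B = 0 -> A *m B = 0.
Proof.
move=> pA /psd_rank1_sum[s ->]; rewrite mxinner_rank1_sum => /eqP.
rewrite psumr_eq0; last by move=> v _; apply: pA.2.
move=> /allP s0; rewrite mulmx_sumr big_seq big1 // => v vs.
by rewrite mulmxA psd_isotropic ?mul0mx //; apply/eqP/s0.
Qed.

(** * Ranks of matrices with orthogonal row spaces *)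

(** Orthogonal row spaces meet in 0, so the ranks add up to that of the stacked
    matrix, and the kernel of the latter is the intersection of the two kernels.
    The scalars are real: a vector orthogonal to itself has to vanish. *)
Lemma mxrank_orthogonal (R : realType) (n : nat) (A B : 'M[R]_n) :
  B *m A^T = 0 ->
  (\rank A + \rank B)%N = (n - \rank (nullspace A :&: nullspace B))%N.
Proof.
move=> BA.
have cap0 : \rank (A :&: B)%MS = 0%N.
  apply/eqP; rewrite mxrank_eq0; apply/eqP/row_matrixP => i; rewrite row0.
  have : (row i (A :&: B) <= A :&: B)%MS by exact: row_sub.
  rewrite sub_capmx => /andP[/submxP[a ua] /submxP[b ub]].
  move: (row i _) ua ub => u ua ub.
  have uu : u *m u^T = 0.
    by rewrite {1}ub ua trmx_mul -mulmxA (mulmxA B) BA mul0mx mulmx0.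
  apply: trmx_inj; rewrite trmx0; apply: mxform1_eq0.
  by rewrite /mxform mulmx1 trmxK uu mxE.
have capE : (nullspace A :&: nullspace B :=: kermx (row_mx A^T B^T))%MS.
  apply/eqmxP/andP; split.
    rewrite sub_kermx mul_mx_row -row_mx0; apply/eqP; congr row_mx.
      by apply/sub_kermxP; exact: capmxSl.
    by apply/sub_kermxP; exact: capmxSr.
  have /eqP := mulmx_ker (row_mx A^T B^T); rewrite mul_mx_row -row_mx0 => /eqP.
  by move=> /eq_row_mx[kA kB]; rewrite sub_capmx; apply/andP; split; apply/sub_kermxP.
have := mxrank_sum_cap A B; rewrite cap0 addn0 => <-.
rewrite capE mxrank_ker -tr_col_mx mxrank_tr -addsmxE subKn //.
exact: rank_leq_col.
Qed.

(** * Compactness of the positive semidefinite matrices of given trace *)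

Lemma mxinnerE (R : realType) (n : nat) (A B : 'M[R]_n) :
  mxinner A B = \sum_i \sum_j A i j * B j i.
Proof. by apply: eq_bigr => i _; rewrite mxE. Qed.

Lemma mxinner_deltal (R : realType) (n : nat) (A : 'M[R]_n) (i j : 'I_n) :
  mxinner (delta_mx i j) A = A j i.
Proof.
by rewrite -(mul_delta_mx (0 : 'I_1)) /mxinner -mulmxA mxtrace_mulC trace_mx11
  -rowE -colE !mxE.
Qed.

Lemma mxinnerC (R : realType) (n : nat) (A B : 'M[R]_n) : mxinner A B = mxinner B A.
Proof. exact: mxtrace_mulC. Qed.

Lemma sum_continuous (R : realType) (T : topologicalType) (I : Type) (r : seq I)
    (f : I -> T -> R) :
  (forall i, continuous (f i)) -> continuous (fun x => \sum_(i <- r) f i x).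
Proof.
move=> cf x; elim: r => [|i r IHr].
  by under eq_fun do rewrite big_nil; exact: cvg_cst.
under eq_fun do rewrite big_cons.
by apply: cvgD; [exact: cf | exact: IHr].
Qed.

Lemma mxinner_continuous (R : realType) (n : nat) (A : 'M[R]_n) :
  continuous (fun v : 'rV[R]_(n * n) => mxinner A (vec_mx v)).
Proof.
under eq_fun do rewrite mxinnerE.
apply: sum_continuous => i; apply: sum_continuous => j.
under eq_fun do rewrite mxE.
by move=> v; apply: cvgMr (@coord_continuous _ _ _ _ _ v).
Qed.

Lemma psd_entry_le (R : realType) (n : nat) (A : 'M[R]_n) (i j : 'I_n) :
  psd A -> `|A i j| <= \tr A.
Proof.
move=> pA; have tr k : A k k <= \tr A.
  by rewrite /mxtrace (bigD1 k) //= lerDl sumr_ge0 // => l _; exact: psd_diag_ge0.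
have tr0 : 0 <= \tr A by apply: le_trans (tr i); exact: psd_diag_ge0.
rewrite -(ler_pXn2r (_ : (0 < 2)%N)) ?nnegrE // real_normK ?num_real //.
have := psd_CauchySchwarz (delta_mx i 0) (delta_mx j 0) pA.
rewrite !mxform_delta => /le_trans; apply; rewrite expr2.
by apply: ler_pM; rewrite ?psd_diag_ge0.
Qed.

(** The entries are bounded by the trace, and the defining conditions are closed,
    being equalities and inequalities on continuous functions <A, .>. On the
    flattened matrices, the bound on the entries describes a product of segments,
    which is compact. *)
Lemma psd_trace_compact (R : realType) (n : nat) (c : R) :
  compact [set v : 'rV[R]_(n * n) | psd (vec_mx v) /\ \tr (vec_mx v) = c]%classic.
Proof.
have box : compact [set v : 'rV[R]_(n * n) | forall k, v ord0 k \in `[(- c), c]%R]%classic.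
  apply: (@rV_compact _ _ (fun=> `[(- c), c]%classic)).
  by move=> _; exact: segment_compact.
apply: subclosed_compact box _; last first.
  move=> v [pv trv] k; rewrite in_itv /= -ler_norml -trv.
  case/mxvec_indexP: k => i j.
  by have := psd_entry_le i j pv; rewrite mxE.
rewrite [X in closed X](_ : _ =
    \bigcap_(p in [set: 'I_n * 'I_n]) [set v : 'rV[R]_(n * n) |
      mxinner (delta_mx p.2 p.1 - delta_mx p.1 p.2) (vec_mx v) = 0]
  `&` \bigcap_(x in [set: 'cV[R]_n]) [set v : 'rV[R]_(n * n) |
      0 <= mxinner (x *m x^T) (vec_mx v)]
  `&` [set v : 'rV[R]_(n * n) | mxinner 1%:M (vec_mx v) = c])%classic.
  apply: closedI; first apply: closedI.
  - apply: closed_bigI => p _.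
    apply: (preimage_closed _ (@closed_eq _ 0)) => v _; exact: mxinner_continuous.
  - apply: closed_bigI => x _.
    apply: (preimage_closed _ (@closed_ge _ 0)) => v _; exact: mxinner_continuous.
  - apply: (preimage_closed _ (@closed_eq _ c)) => v _; exact: mxinner_continuous.
have skewE (v : 'rV[R]_(n * n)) (i j : 'I_n) :
    mxinner (delta_mx j i - delta_mx i j) (vec_mx v) =
      vec_mx v i j - vec_mx v j i.
  by rewrite /mxinner mulmxBl linearB /= -!/(mxinner _ _) !mxinner_deltal.
apply/seteqP; split => v /=.
  move=> [[sv pv] trv]; split; last by rewrite /mxinner mul1mx.
  split=> [p _|x _] /=.
    by rewrite skewE -{1}sv mxE subrr.
  by rewrite mxinnerC -mxform_inner; exact: pv.
move=> [[sv pv] trv]; split; last by move: trv; rewrite /mxinner mul1mx.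
split; last by move=> x; rewrite -/(mxform _ _ _) mxform_inner mxinnerC; exact: pv.
apply/matrixP => i j; apply/eqP; rewrite -subr_eq0; apply/eqP.
rewrite [_^T _ _]mxE; have := sv (j, i) I; rewrite /= skewE; exact.
Qed.

(** * Strong duality *)

Lemma psdD (R : realType) (n : nat) (A B : 'M[R]_n) :
  psd A -> psd B -> psd (A + B).
Proof.
move=> [sA pA] [sB pB]; split; first by rewrite linearD /= sA sB.
by move=> x; rewrite mulmxDr mulmxDl -trace_mx11 mxtraceD !trace_mx11 addr_ge0.
Qed.

Lemma psdZ (R : realType) (n : nat) (a : R) (A : 'M[R]_n) :
  0 <= a -> psd A -> psd (a *: A).
Proof.
move=> a0 [sA pA]; split; first by rewrite linearZ /= sA.
by move=> x; rewrite -scalemxAr -scalemxAl -trace_mx11 mxtraceZ trace_mx11 mulr_ge0.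
Qed.

Lemma psd_rank1 (R : realType) (n : nat) (x : 'cV[R]_n) : psd (x *m x^T).
Proof.
split; first by rewrite trmx_mul trmxK.
move=> z; rewrite -/(mxform _ _ _).
have -> : mxform (x *m x^T) z z = ((z^T *m x) 0 0) ^+ 2.
  rewrite /mxform mulmxA -mulmxA -[x^T *m z]trmxK trmx_mul trmxK.
  by rewrite mxE big_ord1 [_^T 0 0]mxE expr2.
exact: sqr_ge0.
Qed.

Lemma psd1 (R : realType) (n : nat) : psd (1%:M : 'M[R]_n).
Proof.
split; first by rewrite trmx1.
move=> x; rewrite -/(mxform _ _ _) mxform1; apply: sumr_ge0 => i _; exact: sqr_ge0.
Qed.

(** The squared distance from 0 of the vector formed by the failures of X to have
    unit diagonal and to be orthogonal to S: the matrices with residual 0 are those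
    that are primal feasible and complementary to S, once they are positive
    semidefinite. *)
Definition residual (R : realType) (n : nat) (S X : 'M[R]_n) : R :=
  \sum_i (X i i - 1) ^+ 2 + mxinner S X ^+ 2.

Lemma sqr_continuous (R : realType) (T : topologicalType) (f : T -> R) :
  continuous f -> continuous (fun x => f x ^+ 2).
Proof. by move=> cf x; under eq_fun do rewrite expr2; exact: cvgM (cf x) (cf x). Qed.

(** The trace is fixed to n to make the domain compact; the matrices of unit
    diagonal all have this trace. *)
Lemma residual_min (R : realType) (n : nat) (S : 'M[R]_n) :
  exists X : 'M[R]_n, [/\ psd X, \tr X = n%:R &
    forall Z : 'M[R]_n, psd Z -> \tr Z = n%:R -> residual S X <= residual S Z].
Proof.
have [||v vK vmin] := compact_EVT_min _ (@psd_trace_compact R n n%:R)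
    (f := fun v : 'rV[R]_(n * n) => residual S (vec_mx v)).
- by exists (mxvec 1%:M) => /=; rewrite mxvecK mxtrace1; split => //; exact: psd1.
- have diag_c : continuous (fun v : 'rV[R]_(n * n) => \sum_i (vec_mx v i i - 1) ^+ 2).
    apply: sum_continuous => i; apply: sqr_continuous.
    under eq_fun do rewrite mxE.
    move=> v; apply: cvgB (@coord_continuous _ _ _ _ _ v) _; exact: cvg_cst.
  have inner_c := sqr_continuous (mxinner_continuous (A := S)).
  by apply: continuous_subspaceT => v; exact: cvgD (diag_c v) (inner_c v).
move: vK; rewrite inE /= => -[pv trv].
exists (vec_mx v); split => // Z pZ trZ.
by have := vmin (mxvec Z); rewrite mxvecK; apply; rewrite inE /= mxvecK.
Qed.

(** If b < 0, then t = - b / (|c| - b) lies in (0, 1] and makes the quadratic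
    negative, since there t c <= t |c| = - b + t b < - 2 b. *)
Lemma first_variation_ge0 (R : realType) (b c : R) :
  (forall t, 0 < t -> t <= 1 -> 0 <= 2 * t * b + t ^+ 2 * c) -> 0 <= b.
Proof.
move=> H; rewrite leNgt; apply/negP => b0.
have k0 : 0 < `|c| - b by rewrite subr_gt0 (lt_le_trans b0).
have := H (- b / (`|c| - b)); rewrite divr_gt0 ?oppr_gt0 // ler_pdivrMr //.
rewrite mul1r lerDr normr_ge0 => /(_ isT isT).
set t := - b / _; have t0 : 0 < t by rewrite divr_gt0 ?oppr_gt0.
have tE : t * (`|c| - b) = - b by rewrite mulfVK // gt_eqF.
have : t * c <= t * `|c| by rewrite ler_pM2l // ler_norm.
have -> : 2 * t * b + t ^+ 2 * c = t * (2 * b + t * c) by ring.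
rewrite pmulr_rge0 //; nra.
Qed.

(** The nearest point inequality in a convex set. The derivative of the residual
    at X towards Z is nonnegative; this is the statement once the terms of X are
    collected, because the numbers X_ii - 1 sum to 0. *)
Lemma residual_variation (R : realType) (n : nat) (S X Z : 'M[R]_n) :
  psd X -> \tr X = n%:R ->
  (forall Z : 'M[R]_n, psd Z -> \tr Z = n%:R -> residual S X <= residual S Z) ->
  psd Z -> \tr Z = n%:R ->
  residual S X <= \sum_i (X i i - 1) * Z i i + mxinner S X * mxinner S Z.
Proof.
move=> pX trX Xmin pZ trZ.
pose D := Z - X.
have innerD t : mxinner S (X + t *: D) = mxinner S X + t * mxinner S D.
  by rewrite /mxinner mulmxDr -scalemxAr mxtraceD mxtraceZ.
pose b := \sum_i (X i i - 1) * D i i + mxinner S X * mxinner S D.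
have b0 : 0 <= b.
  apply: (@first_variation_ge0 _ _ (\sum_i D i i ^+ 2 + mxinner S D ^+ 2)) => t t0 t1.
  have := Xmin (X + t *: D).
  have -> : residual S (X + t *: D) = residual S X +
      (2 * t * b + t ^+ 2 * (\sum_i D i i ^+ 2 + mxinner S D ^+ 2)).
    rewrite /residual innerD /b.
    have XtE i : (X + t *: D) i i = X i i + t * D i i by rewrite mxE [(t *: D) i i]mxE.
    under eq_bigr do rewrite XtE.
    have -> : \sum_i (X i i + t * D i i - 1) ^+ 2 = \sum_i (X i i - 1) ^+ 2
       + 2 * t * (\sum_i (X i i - 1) * D i i) + t ^+ 2 * \sum_i D i i ^+ 2.
      by rewrite !mulr_sumr -!big_split /=; apply: eq_bigr => i _; ring.
    ring.
  rewrite lerDl; apply.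
    have -> : X + t *: D = (1 - t) *: X + t *: Z.
      by rewrite /D scalerBr scalerBl scale1r addrA addrAC.
    by apply: psdD; apply: psdZ => //; rewrite ?subr_ge0 // ltW.
  by rewrite mxtraceD mxtraceZ /D linearB /= trX trZ subrr mulr0 addr0.
have sum0 : \sum_i (X i i - 1) = 0.
  by rewrite big_split /= -/(mxtrace X) trX sumrN sumr_const card_ord subrr.
have innerB : mxinner S D = mxinner S Z - mxinner S X.
  by rewrite /mxinner /D linearB /= linearB.
rewrite -subr_ge0; suff <- : b = \sum_i (X i i - 1) * Z i i
   + mxinner S X * mxinner S Z - residual S X by [].
rewrite /b /residual innerB.
have -> : \sum_i (X i i - 1) * D i i =
    \sum_i (X i i - 1) * Z i i - \sum_i (X i i - 1) ^+ 2 - \sum_i (X i i - 1).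
  rewrite -!sumrB; apply: eq_bigr => i _; rewrite !mxE; ring.
rewrite sum0; ring.
Qed.

Lemma mxform_diag (R : realType) (n : nat) (d : 'rV[R]_n) (x : 'cV[R]_n) :
  mxform (diag_mx d) x x = \sum_i d 0 i * x i 0 ^+ 2.
Proof.
rewrite /mxform mul_mx_diag mxE; apply: eq_bigr => i _; rewrite !mxE; ring.
Qed.

(** A theorem of the alternative: if no primal feasible matrix is complementary to
    S, then S is not dual optimal, because the residual at its minimum X provides
    a descent direction z. *)
Lemma psd_alternative (R : realType) (n : nat) (S : 'M[R]_n) :
  psd S ->
  (exists X : 'M[R]_n, maxcut_feasible X /\ mxinner S X = 0) \/
  (exists z : 'rV[R]_n, \sum_i z 0 i < 0 /\ psd (S + diag_mx z)).
Proof.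
move=> pS; have [X [pX trX Xmin]] := residual_min S.
have diag0 : 0 <= \sum_i (X i i - 1) ^+ 2 by apply: sumr_ge0 => i _; exact: sqr_ge0.
have res0 : 0 <= residual S X by rewrite addr_ge0 ?sqr_ge0.
have [resX0|resX0] := eqVneq (residual S X) 0.
  left; exists X; move/eqP: resX0; rewrite paddr_eq0 ?sqr_ge0 //.
  rewrite sqrf_eq0 psumr_eq0 => [|i _]; last exact: sqr_ge0.
  move=> /andP[/allP dX /eqP ->]; split=> //; split=> // i.
  by apply/eqP; rewrite -subr_eq0 -sqrf_eq0; apply: dX; rewrite mem_index_enum.
(* By the first order condition, s S + Diag (X_ii - 1) is at least delta / n on
   unit vectors. The numbers X_ii - 1 sum to 0, so shifting them by - delta / n
   makes their sum negative and keeps the form nonnegative. *)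
right; set delta := residual S X in res0 resX0; set s := mxinner S X.
have delta_gt0 : 0 < delta by rewrite lt_def resX0.
have n0 : n != 0%N.
  apply/eqP => n0; move: resX0; rewrite /delta /residual.
  subst n; rewrite big_ord0 add0r /mxinner /mxtrace big_ord0.
  by rewrite expr0n eqxx.
have nR : 0 < n%:R :> R by rewrite ltr0n lt0n.
have s0 : 0 <= s by exact: psd_inner_ge0.
pose d : 'rV[R]_n := \row_i (X i i - 1 - delta / n%:R).
have pP : psd (s *: S + diag_mx d).
  split; first by rewrite linearD linearZ /= tr_diag_mx pS.1.
  move=> x; rewrite -/(mxform _ _ _).
  have [->|x0] := eqVneq x 0; first by rewrite /mxform mulmx0 mxE.
  have xx : 0 < mxform 1%:M x x.
    rewrite lt_def (psd1 R n).2 andbT.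
    by apply: contraNneq x0 => /mxform1_eq0 ->.
  set q := mxform 1%:M x x in xx.
  have k0 : 0 < n%:R / q by rewrite divr_gt0.
  (* The factor n / |x|^2 gives x x^T trace n. *)
  have := residual_variation pX trX Xmin (psdZ (ltW k0) (psd_rank1 x)).
  have trxx : \tr (x *m x^T) = q.
    by rewrite /q mxform_inner /mxinner mul1mx.
  rewrite mxtraceZ trxx mulfVK ?gt_eqF // => /(_ erefl).
  have -> : mxinner S (n%:R / q *: (x *m x^T)) = n%:R / q * mxform S x x.
    by rewrite mxform_inner /mxinner -scalemxAr mxtraceZ.
  have -> : \sum_i (X i i - 1) * (n%:R / q *: (x *m x^T)) i i
      = n%:R / q * \sum_i (X i i - 1) * x i 0 ^+ 2.
    rewrite mulr_sumr; apply: eq_bigr => i _; rewrite !mxE big_ord1 mxE; ring.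
  rewrite -/s -/delta mulrCA -mulrDr -ler_pdivrMl // invf_div => H.
  have -> : mxform (s *: S + diag_mx d) x x = s * mxform S x x + mxform (diag_mx d) x x.
    by rewrite !mxform_inner /mxinner mulmxDl mxtraceD -scalemxAl mxtraceZ.
  have -> : mxform (diag_mx d) x x =
      \sum_i (X i i - 1) * x i 0 ^+ 2 - q / n%:R * delta.
    rewrite mxform_diag /q mxform1 mulrAC -mulrA mulr_suml -sumrB; apply: eq_bigr => i _.
    rewrite mxE; ring.
  by rewrite addrA subr_ge0 addrC.
have e0 : 0 < (1 + s)^-1 by rewrite invr_gt0 ltr_pwDl.
have e1 : 1 + s != 0 by rewrite gt_eqF // ltr_pwDl.
(* As s may be 0, s S + Diag d is not divided by s: adding S to it first makes
   the coefficient of S equal to 1 + s > 0. *)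
exists ((1 + s)^-1 *: d); split.
  have -> : \sum_i ((1 + s)^-1 *: d) 0 i = (1 + s)^-1 * \sum_i d 0 i.
    by rewrite mulr_sumr; apply: eq_bigr => i _; rewrite mxE.
  rewrite pmulr_rlt0 //; under eq_bigr do rewrite mxE.
  rewrite !sumrB -/(mxtrace X) trX !sumr_const card_ord subrr sub0r oppr_lt0.
  by rewrite pmulrn_lgt0 ?lt0n ?divr_gt0.
have -> : S + diag_mx ((1 + s)^-1 *: d) =
    (1 + s)^-1 *: (S + (s *: S + diag_mx d)).
  rewrite [diag_mx _]linearZ /= addrA -{2}[S]scale1r -scalerDl scalerDr scalerA.
  by rewrite mulVf // scale1r.
by apply: psdZ (ltW e0) _; exact: psdD.
Qed.

Lemma duality_gap (R : realType) (n : nat) (w : 'I_n -> 'I_n -> R)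
    (y : 'rV[R]_n) (S X : 'M[R]_n) :
  S = diag_mx y - 4^-1 *: laplacian w -> (forall i, X i i = 1) ->
  mxinner S X = dual_obj y - maxcut_obj w X.
Proof.
move=> -> X1; rewrite /maxcut_obj /mxinner mulmxBl linearB /= -scalemxAl mxtraceZ.
congr (_ - _); apply: eq_bigr => i _.
by rewrite mul_diag_mx mxE X1 mulr1.
Qed.

(** Weak duality bounds the value of every primal feasible matrix by that of S;
    the alternative provides one that reaches this bound, so the optimal X
    reaches it too and <S, X> = 0. *)
Lemma complementary_slackness (R : realType) (n : nat) (w : 'I_n -> 'I_n -> R)
    (X : 'M[R]_n) (y : 'rV[R]_n) (S : 'M[R]_n) :
  maxcut_optimal w X -> dual_optimal w y S -> S *m X = 0.
Proof.
move=> [[X1 pX] Xmax] [[SE pS] ymin].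
apply: psd_inner_eq0 => //; apply/le_anti; rewrite psd_inner_ge0 // andbT.
case: (psd_alternative pS) => [[Z [Zf Z0]]|[z [z0 pz]]].
  have := Xmax Z Zf; rewrite -subr_ge0 (duality_gap SE X1).
  have := duality_gap SE Zf.1; rewrite Z0; lra.
have : dual_obj y <= dual_obj (y + z).
  apply: (ymin _ (S + diag_mx z)); split=> //.
  by rewrite SE linearD /= addrAC.
rewrite /dual_obj; under [X in _ <= X -> _]eq_bigr do rewrite mxE.
by rewrite big_split /= lerDl leNgt z0.
Qed.

Theorem lemma16 (R : realType) (n : nat) (e : rel 'I_n)
    (w : 'I_n -> 'I_n -> R)
    (simple_e : simple_graph e)
    (weights_w : edge_weights e w)
    (w_ge0 : forall i j : 'I_n, 0 <= w i j)
    (X : 'M[R]_n) (y : 'rV[R]_n) (S : 'M[R]_n)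
    (X_opt : maxcut_optimal w X)
    (S_opt : dual_optimal w y S) :
  (\rank X + \rank S)%N = (n - \rank (nullspace X :&: nullspace S))%N.
Proof.
apply: mxrank_orthogonal; rewrite X_opt.1.2.1; exact: complementary_slackness S_opt.
Qed.
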